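(* Let $u:\mathbb{Z}_+^2\setminus\{(0,0)\}\to\mathbb{R}_+$ be a mass function that is eventually decreasing in both arguments. Let $\alpha_1,\alpha_2>0$, and let $b_1\in RV_{1/\alpha_1}$ and $b_2\in RV_{1/\alpha_2}$ be two continuous, strictly increasing scaling functions such that, for some $\rho<0$, some $h\in RV_\rho$ and some function $\lambda$ on $(0,\infty)^2$, $$\lim_{n\to\infty}\frac{u([b_1(n)x],[b_2(n)y])}{h(n)}=\lambda(x,y)>0\qquad\text{for all }x,y>0,$$ where $n$ runs through the positive integers. Then the limit function satisfies the scaling property $$\lambda(s^{1/\alpha_1}x,s^{1/\alpha_2}y)=s^{\rho}\lambda(x,y)\qquad\text{for all } s,x,y>0,$$ and $g(x,y):=u([x],[y])$ is an eventually decreasing regularly varying function such that $$\lim_{t\to\infty}\frac{g(b_1(t)x,b_2(t)y)}{h(t)}=\lambda(x,y)>0\qquad\text{for all }x,y>0,$$ where $t$ runs through the positive reals. Thus $u$ is embeddable in the regularly varying function $g$.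
   Context: $\mathbb{Z}_+=\{0,1,2,\dots\}$, $\mathbb{R}_+=[0,\infty)$, and $[x]$ is the largest integer $\le x$. For $\rho\in\mathbb{R}$, $h\in RV_\rho$ means that $h:(0,\infty)\to(0,\infty)$ is measurable and $\lim_{t\to\infty}h(tx)/h(t)=x^\rho$ for all $x>0$. A mass function here is a non-negative function on the lattice points. ''Eventually decreasing in both arguments'' means: there is $M$ such that on the region where both arguments are at least $M$ the function is non-increasing in each argument separately. A measurable function $g$ on $\mathbb{R}_+^2$ is regularly varying with scaling functions $b_1,b_2$ and limit function $\lambda$ if there is $h\in RV_\alpha$ for some $\alpha\in\mathbb{R}$ such that $\lim_{t\to\infty} g(b_1(t)x,b_2(t)y)/h(t)=\lambda(x,y)>0$ for all $x,y>0$. The doubly indexed function $u$ is embeddable if $g(x,y):=u([x],[y])$ is a regularly varying function in this sense. The function $g$ is considered at points $(x,y)$ with $([x],[y])\ne(0,0)$. *)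

(* Defs.v *)
From HB Require Import structures.
From mathcomp Require Import all_boot all_order all_algebra.
From mathcomp Require Import all_classical all_reals all_analysis.
Set Implicit Arguments.
Unset Strict Implicit.
Unset Printing Implicit Defensive.
Import Order.TTheory GRing.Theory Num.Theory.
Import numFieldNormedType.Exports.

Local Open Scope classical_set_scope.
Local Open Scope ring_scope.

(* Functions on (0, +oo) are total functions R -> R of which only the
   restriction to `]0, +oo[ matters; measurable means Borel measurable. *)
Definition regularly_varying (R : realType) (rho : R) (h : R -> R) : Prop :=
  [/\ measurable_fun (`]0, +oo[ : set R) h,
      (forall t, 0 < t -> 0 < h t) &
      forall x, 0 < x -> h (t * x) / h t @[t --> +oo] --> x `^ rho].

(* The domain of u: a function on it is a total function nat -> nat -> R whose
   value at (0, 0) is never used. *)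
Definition lattice_dom : set (nat * nat) := [set p | p != (0%N, 0%N)].

(* On the nonnegative reals, Num.truncn is the integer part. *)
Definition plane_dom (R : realType) : set (R * R) :=
  [set p | [/\ 0 <= p.1, 0 <= p.2 &
               lattice_dom (Num.truncn p.1, Num.truncn p.2)]].

Definition lattice_ext (R : realType) (u : nat -> nat -> R) (x y : R) : R :=
  u (Num.truncn x) (Num.truncn y).

Definition eventually_decreasing (R : realType) (d : Order.disp_t)
    (T : porderType d) (D : set (T * T)) (f : T -> T -> R) : Prop :=
  exists M : T,
    (forall x x' y, (M <= x)%O -> (x <= x')%O -> (M <= y)%O ->
       D (x, y) -> D (x', y) -> f x' y <= f x y) /\
    (forall x y y', (M <= x)%O -> (M <= y)%O -> (y <= y')%O ->
       D (x, y) -> D (x, y') -> f x y' <= f x y).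

(* g is only defined on plane_dom, so the existence of the limit includes that
   (b1 t * x, b2 t * y) lies in plane_dom for all large t. *)
Definition rv2_limit (R : realType) (b1 b2 h : R -> R) (lam g : R -> R -> R)
    : Prop :=
  forall x y, 0 < x -> 0 < y ->
    [/\ \forall t \near +oo, plane_dom (b1 t * x, b2 t * y),
        g (b1 t * x) (b2 t * y) / h t @[t --> +oo] --> lam x y &
        0 < lam x y].

Definition regularly_varying2 (R : realType) (b1 b2 : R -> R)
    (lam g : R -> R -> R) : Prop :=
  measurable_fun (@plane_dom R) (fun p : R * R => g p.1 p.2) /\
  exists alpha : R, exists h : R -> R,
    regularly_varying alpha h /\ rv2_limit b1 b2 h lam g.

Definition embeddable (R : realType) (u : nat -> nat -> R) : Prop :=
  exists (b1 b2 : R -> R) (lam : R -> R -> R),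
    regularly_varying2 b1 b2 lam (lattice_ext u).

(* Main.v *)
Require Import Defs.
From HB Require Import structures.
From mathcomp Require Import all_boot all_order all_algebra.
From mathcomp Require Import all_classical all_reals all_analysis.
From mathcomp Require Import measurable_realfun ring lra.
Set Implicit Arguments.
Unset Strict Implicit.
Unset Printing Implicit Defensive.
Import Order.TTheory GRing.Theory Num.Theory.
Import numFieldNormedType.Exports.

Local Open Scope classical_set_scope.
Local Open Scope ring_scope.

(* For a positive measurable function, regular variation is automatically
   locally uniform: h(w)/h(v) -> s^rho as soon as v -> oo and w/v -> s (the
   uniform convergence theorem, proved here by the classical argument that two
   subsets of a short interval with large Lebesgue measure must meet).  Applied
   to b1 and b2, it puts b_i(w) between b_i(v) s1^(1/alpha_i) and
   b_i(v) s2^(1/alpha_i) for any s1 < s < s2, so monotonicity of u sandwiches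
   g at scale w between values of g at scale v.  With v = n, w = [s n] this
   gives phi(s2) <= s^rho phi(1) <= phi(s1) for
   phi(s) = lam(s^(1/alpha1) x, s^(1/alpha2) y), and continuity of the power
   function, not of lam, forces phi(s) = s^rho phi(1).  With v = [t], w = t the
   same sandwich then passes the limit from integers to reals. *)

(** The pushforward of Lebesgue measure under a translation agrees with it on half-open intervals,
    and these determine the measure. *)
Lemma lebesgue_measure_translate (R : realType) (c : R) (A : set R) :
  measurable A ->
  lebesgue_measure [set x | A (x - c)] = lebesgue_measure A.
Proof.
move=> mA.
have mf : @measurable_fun _ _ (measurableTypeR R) (measurableTypeR R)
    setT (fun x : R => x - c).
  by apply: measurable_funB => //; exact: measurable_cst.
rewrite [RHS](lebesgue_measure_unique
  (mu := measure_function_pushforward__canonical__measure_function_Measure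
     (lebesgue_measure : {measure set (measurableTypeR R) -> \bar R}) mf)) //.
move=> X [[a b] _ <-] /=; rewrite /pushforward.
have -> : (fun x : R => x - c) @^-1` `]a, b] = [set` `]a + c, b + c]].
  by apply/seteqP; split => x /=; rewrite !in_itv /= ltrBrDr lerBlDr.
rewrite !lebesgue_measure_itv /= !lte_fin ltrD2r.
by case: ifPn => // _; rewrite -!EFinB; congr EFin; ring.
Qed.

(** * The uniform convergence theorem, in additive (logarithmic) form *)

Section uniform_convergence.
Variables (R : realType) (k : R -> R).
Hypothesis mk : measurable_fun [set: R] k.
Hypothesis kD : forall a, k (x + a) - k x @[x --> +oo] --> 0.

(** Fixing [N] turns convergence for each single shift into a bound uniform over a set of shifts, in
    the manner of Egorov's theorem. *)
Definition small_increments (y : R^nat) (e : R) (N : nat) : set R :=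
  `[0, 1] `&` [set a | forall m, (N <= m)%N -> `|k (y m + a) - k (y m)| < e].

Lemma measurable_small_increments y e N :
  measurable (small_increments y e N).
Proof.
apply: measurableI; first exact: measurable_itv.
have -> : [set a | forall m, (N <= m)%N -> `|k (y m + a) - k (y m)| < e] =
    \bigcap_m [set a | (N <= m)%N -> `|k (y m + a) - k (y m)| < e].
  by apply/seteqP; split => a /= H m; [move=> _; exact: H|exact: H].
apply: bigcapT_measurable => m.
case: (leqP N m) => Nm; last first.
  rewrite (_ : mkset _ = setT); first exact: measurableT.
  by apply/seteqP; split => a //= /(leq_trans Nm); rewrite ltnn.
have -> : [set a | true -> `|k (y m + a) - k (y m)| < e] =
    setT `&` (fun a => `|k (y m + a) - k (y m)|) @^-1` `]-oo, e[.
  apply/seteqP; split => a /=; rewrite in_itv /=; first by move=> /(_ isT).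
  by case.
have mf : measurable_fun [set: R] (fun a => `|k (y m + a) - k (y m)|).
  apply: (@measurableT_comp _ _ _ _ _ _ (@Num.norm R R)).
    exact: normr_measurable.
  apply: measurable_funB; last exact: measurable_cst.
  apply: (measurableT_comp mk).
  by apply: measurable_funD => //; exact: measurable_cst.
exact: mf.
Qed.

(** By [kD], these sets increase with [N] to all of [[0, 1]], so continuity from below brings their
    measure to 1. The bound 3/4 is half the length of the interval that later contains two of
    them. *)
Lemma small_increments_full y e : y @ \oo --> +oo -> 0 < e ->
  \forall N \near \oo,
    ((3 / 4)%:E < lebesgue_measure (small_increments y e N))%E.
Proof.
move=> yoo e0.
have U : \bigcup_N small_increments y e N = [set` `[0, 1]].
  apply/seteqP; split => [a [N _ []]//|a a01].
  have /cvg_pinftyP/(_ y yoo)/cvgrPdist_lt/(_ e e0) := kD a.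
  move=> [N _ HN]; exists N => //; split => // m Nm.
  by have := HN m Nm; rewrite /= sub0r normrN.
have H : lebesgue_measure (small_increments y e N) @[N --> \oo] -->
    (lebesgue_measure (\bigcup_N small_increments y e N) : \bar R).
  apply: (@nondecreasing_cvg_mu _ (measurableTypeR R) R lebesgue_measure).
  - by move=> N; exact: measurable_small_increments.
  - by rewrite U; exact: measurable_itv.
  - move=> M N MN; apply/subsetPset => a [a01 Ha]; split => // m Nm.
    by apply: Ha; exact: leq_trans MN Nm.
rewrite U lebesgue_measure_itv /= lte_fin ltr01 in H.
apply: (H [set z | (3 / 4)%:E < z]%E).
rewrite -EFinB.
apply: open_nbhs_nbhs; split; first exact: open_ereal_gt_ereal.
by rewrite /= lte_fin; lra.
Qed.

(** It suffices to find one point [x n + a] at which [k] is within [e / 2] of both [k (x n)] and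
    [k (x n + d n)]. *)
Lemma slowly_varying_cvg (x d : R^nat) : x @ \oo --> +oo -> d @ \oo --> 0 ->
  k (x n + d n) - k (x n) @[n --> \oo] --> 0.
Proof.
move=> xoo d0.
apply/cvgrPdist_lt => e e0.
have e20 : 0 < e / 2 by rewrite divr_gt0.
have yoo : x n + d n @[n --> \oo] --> +oo.
  apply/cvgryPge => A.
  have /cvgryPge/(_ (A + 1)) := xoo.
  have : \forall n \near \oo, -1 < d n by apply: (cvgr_gt _ d0); lra.
  by apply: filterS2 => n; lra.
have := small_increments_full xoo e20.
have := small_increments_full yoo e20.
have /cvgrPdist_lt/(_ (1/4)) := d0; rewrite divr_gt0// => /(_ isT).
apply: filterS3 => n; rewrite /= sub0r normrN sub0r normrN => dn HW HV.
set W := small_increments _ _ _ in HW.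
set V := small_increments _ _ _ in HV.
have mW : measurable W by exact: measurable_small_increments.
have mV : measurable V by exact: measurable_small_increments.
(* [V] holds shifts from [x n] and [W] shifts from [x n + d n]; translating [W] by [d n] makes both
   refer to the end point [x n + a]. As [d n] is below 1/4 in absolute value, [W'] stays in
   [[-1/4, 5/4]]. *)
pose W' := [set a | W (a - d n)].
have muW : lebesgue_measure W' = lebesgue_measure W.
  exact: lebesgue_measure_translate.
have mW' : measurable W'.
  have mf : measurable_fun [set: R] (fun x : R => x - d n).
    by apply: measurable_funB => //; exact: measurable_cst.
  by rewrite -[W']setTI; exact: mf.
have [a [[a01 Va] [_ Wa]]] : exists a, V a /\ W' a.
  apply/not_existsP => disj.
  have VW0 : V `&` W' = set0.
    by apply/seteqP; split => a //= VWa; exact: disj VWa.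
  have muVW : lebesgue_measure (V `|` W') =
      (lebesgue_measure V + lebesgue_measure W)%E.
    rewrite -muW.
    exact: (@measureU _ R (measurableTypeR R) lebesgue_measure _ _ mV mW' VW0).
  (* Disjoint sets of measure > 3/4 do not both fit in [-1/4, 5/4]. *)
  have : (lebesgue_measure (V `|` W') <= (3 / 2)%:E)%E.
    have -> : (3 / 2)%:E = lebesgue_measure (`[- (1 / 4), 5 / 4] : set R).
      rewrite lebesgue_measure_itv /= lte_fin ifT; last lra.
      by rewrite -EFinB; congr EFin; lra.
    apply: le_measure; rewrite ?inE.
    - exact: measurableU.
    - exact: measurable_itv.
    - move: dn; rewrite ltr_norml => dn.
      by move=> a [[]|[]] /=; rewrite !in_itv /=; lra.
  rewrite muVW leNgt => /negP; apply.
  by rewrite (_ : (3 / 2)%:E = (3 / 4)%:E + (3 / 4)%:E)%E ?lteD//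
    -EFinD; congr EFin; lra.
have {}Va := Va n (leqnn n); have {}Wa := Wa n (leqnn n).
rewrite (_ : x n + d n + (a - d n) = x n + a) in Wa; last by ring.
move: Va Wa; rewrite !ltr_norml; lra.
Qed.
End uniform_convergence.

(** * Regular variation along sequences *)

Lemma powR_continuous (R : realType) (r s : R) : 0 < s ->
  a `^ r @[a --> s] --> s `^ r.
Proof.
move=> s0.
have E (a : R) : 0 < a -> a `^ r = expR (r * ln a).
  by move=> a0; rewrite /powR gt_eqF.
rewrite E //; apply: (@cvg_trans _ ((fun a => expR (r * ln a)) @ s)).
  apply: near_eq_cvg; near=> a; rewrite E //; near: a.
  exact: lt_nbhsr.
apply: (@cvg_comp _ _ _ (fun a => r * ln a) expR _ (nbhs (r * ln s)));
  last exact: continuous_expR.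
by apply: cvgMl_tmp; exact: continuous_ln.
Unshelve. all: by end_near. Qed.

Lemma cvgy_expR (R : realType) : expR x @[x --> +oo] --> (+oo : set_system R).
Proof.
apply: (@ger_cvgy _ _ _ _ id) => //; near=> x.
by apply: le_trans (expR_ge1Dx x); rewrite lerDr.
Unshelve. all: by end_near. Qed.

Section regular_variation.
Variables (R : realType) (rho : R) (h : R -> R).
Hypothesis h_rv : regularly_varying rho h.

(** In the coordinate [x = ln t], dividing out the power [t ^ rho] leaves [k], the logarithm of a
    slowly varying function, whose increments tend to 0. The previous section applies with base
    points [ln (v n)] and shifts [ln (w n / v n)]. *)
Lemma regularly_varying_equiv (v w : R^nat) : v @ \oo --> +oo ->
  w n / v n @[n --> \oo] --> (1 : R) ->
  h (w n) / h (v n) @[n --> \oo] --> (1 : R).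
Proof.
case: h_rv => mh h0 hlim voo wv.
pose k x := ln (h (expR x)) - rho * x.
have mk : measurable_fun [set: R] k.
  apply: measurable_funB; last first.
    by apply: measurable_funM => //; exact: measurable_cst.
  apply: (measurableT_comp (@measurable_ln R)).
  apply: (@measurable_comp _ _ _ _ _ _ (`]0, +oo[ : set R) h setT expR) => //.
  - by move=> _ [x _ <-] /=; rewrite in_itv /= expR_gt0.
have kD a : k (x + a) - k x @[x --> +oo] --> (0 : R).
  have -> : (0 : R) = ln (expR a `^ rho) - rho * a.
    by rewrite ln_powR expRK subrr.
  apply: (@cvg_trans _
     ((fun x => ln (h (expR x * expR a) / h (expR x)) - rho * a) @ +oo)).
    apply: near_eq_cvg; near=> x; rewrite /k expRD.
    rewrite ln_div ?posrE ?h0 ?mulr_gt0 ?expR_gt0//; ring.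
  apply: cvgB; last exact: cvg_cst.
  apply: (@cvg_comp _ _ _ (fun x => h (expR x * expR a) / h (expR x)) (@ln R)
    _ (nbhs (expR a `^ rho))).
    apply: (@cvg_comp _ _ _ expR (fun t => h (t * expR a) / h t) _ +oo).
      exact: cvgy_expR.
    exact/hlim/expR_gt0.
  by apply: continuous_ln; rewrite powR_gt0 ?expR_gt0.
have v0 : \forall n \near \oo, 0 < v n by move/cvgryPgt: voo; exact.
have w0 : \forall n \near \oo, 0 < w n.
  have : \forall n \near \oo, 0 < w n / v n by apply: (cvgr_gt _ wv).
  apply: filterS2 v0 => n v0; by rewrite pmulr_lgt0 ?invr_gt0.
pose x n := ln (v n); pose d n := ln (w n / v n).
have xoo : x @ \oo --> +oo.
  apply/cvgryPge => A; move/cvgryPge : voo => /(_ (expR A)).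
  apply: filterS2 v0 => n v0 Av; rewrite /x -[A]expRK.
  by rewrite ler_ln ?posrE ?expR_gt0.
have d0 : d @ \oo --> (0 : R).
  rewrite -ln1; apply: cvg_comp wv _; exact: continuous_ln.
have rd0 : rho * d n @[n --> \oo] --> 0.
  by rewrite -(mulr0 rho); exact: cvgMl_tmp.
(* This sum is [ln (h (w n) / h (v n))]: the linear term restores the power removed in [k]. *)
have H : rho * d n + (k (x n + d n) - k (x n)) @[n --> \oo] --> (0 : R).
  by rewrite -(addr0 0); exact: cvgD rd0 (slowly_varying_cvg mk kD xoo d0).
have := cvg_comp _ _ H (@continuous_expR R 0); rewrite expR0.
apply: cvg_trans; apply: near_eq_cvg.
apply: filterS2 v0 w0 => n v0 w0.
have xd : x n + d n = ln (w n) by rewrite /x /d ln_div ?posrE// addrC subrK.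
rewrite [LHS]/= xd /k !lnK ?posrE//.
transitivity (expR (ln (h (w n) / h (v n)))).
  by rewrite ln_div ?posrE ?h0// -xd; congr expR; ring.
by rewrite lnK // posrE divr_gt0 ?h0.
Unshelve. all: by end_near. Qed.

(** Insert [h (v n * s)]: the ratio [h (w n) / h (v n * s)] tends to 1 by the previous lemma, and
    [h (v n * s) / h (v n)] is the defining limit. *)
Lemma regularly_varying_cvg (v w : R^nat) (s : R) : 0 < s -> v @ \oo --> +oo ->
  w n / v n @[n --> \oo] --> s -> h (w n) / h (v n) @[n --> \oo] --> s `^ rho.
Proof.
move=> s0 voo wv; have [_ h0 hlim] := h_rv.
have vsoo : v n * s @[n --> \oo] --> +oo.
  apply/cvgryPge => A; move/cvgryPge : voo => /(_ (A / s)).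
  by apply: filterS => n; rewrite ler_pdivrMr.
have wvs : w n / (v n * s) @[n --> \oo] --> (1 : R).
  rewrite -(divff (lt0r_neq0 s0)).
  under eq_fun do rewrite invfM mulrA.
  exact: cvgMr_tmp.
rewrite -(mul1r (s `^ rho)).
have /cvg_pinftyP/(_ v voo) := hlim s s0.
move/(cvgM (regularly_varying_equiv vsoo wvs)).
apply: cvg_trans; apply: near_eq_cvg.
have : \forall n \near \oo, 0 < v n by move/cvgryPgt: voo; exact.
apply: filterS => n v0 /=.
by rewrite mulrA divfK// gt_eqF// h0// mulr_gt0.
Qed.

End regular_variation.

(** If [b] were bounded with supremum [B], doubling a large argument would multiply a value close to
    [B] by nearly [2 ^ a > 1] and exceed [B]. *)
Lemma incr_regularly_varying_cvgy (R : realType) (a : R) (b : R -> R) : 0 < a ->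
  regularly_varying a b -> (forall s t : R, 0 < s -> s < t -> b s < b t) ->
  b t @[t --> +oo] --> +oo.
Proof.
move=> a0 [_ b0 blim] b_incr; apply/cvgryPge => A.
suff [t0 t00 At0] : exists2 t, 0 < t & A <= b t.
  near=> t; apply/(le_trans At0)/ltW/b_incr => //; near: t.
  by apply: nbhs_pinfty_gt; exact: num_real.
apply: contrapT => bA.
have ubA : ubound (b @` `]0, +oo[) A.
  move=> _ [t + <-]; rewrite /= in_itv /= andbT => t0.
  by rewrite leNgt; apply/negP => /ltW At; apply: bA; exists t.
pose B := sup (b @` `]0, +oo[).
have supB : has_sup (b @` `]0, +oo[).
  by split; [exists (b 1), 1 => //=; rewrite in_itv /= ltr01|exists A].
have bB t : 0 < t -> b t <= B.
  move=> t0; apply: sup_upper_bound => //.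
  by exists t => //=; rewrite in_itv /= t0.
have B0 : 0 < B by apply: lt_le_trans (bB 1 ltr01); exact: b0.
have pow2 : 1 < 2 `^ a :> R.
  apply: (@le_lt_trans _ _ (1 `^ a)); first by rewrite powR1.
  apply: gt0_ltr_powR; rewrite ?nnegrE ?ler01 ?ler0n//.
  by rewrite ltr1n.
(* Any [c] strictly between 1 and [2 ^ a] serves: values above [B / c] exist, and eventually
   [b (2 t) > c * b t]. *)
pose c : R := (1 + 2 `^ a) / 2.
have c1 : 1 < c by rewrite /c; lra.
have c0 : 0 < c by lra.
have [_ [t0 + <-] Bt0] : exists2 z, (b @` `]0, +oo[) z & B - (B - B / c) < z.
  apply: sup_adherent => //.
  by rewrite subr_gt0 ltr_pdivrMr// ltr_pMr.
rewrite /= in_itv /= andbT => t00.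
have [t [tt0 ct]] : exists t, t0 < t /\ c < b (t * 2) / b t.
  apply: (@filter_ex _ (+oo : set_system R)); apply: filterI.
    by apply: nbhs_pinfty_gt; exact: num_real.
  by apply: (cvgr_gt _ (blim 2 _)); rewrite ?ltr0n// /c; lra.
have tp : 0 < t by exact: lt_trans t00 tt0.
have := bB (t * 2); rewrite mulr_gt0// => /(_ isT).
rewrite leNgt => /negP; apply.
rewrite ltr_pdivlMr ?b0// in ct; apply: lt_trans ct.
have := b_incr _ _ t00 tt0; rewrite opprB addrC subrK ltr_pdivrMr// in Bt0.
by rewrite mulrC => h; apply: (lt_trans Bt0); rewrite ltr_pM2r.
Unshelve. all: by end_near. Qed.

(** * The step function extending a lattice function to the quadrant *)

Section lattice_extension.
Variables (R : realType) (u : nat -> nat -> R).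

(** Such a set is a countable union of rectangles on which both integer parts are constant. *)
Lemma measurable_truncn_pair (P : set (nat * nat)) :
  measurable [set p : R * R | P (Num.truncn p.1, Num.truncn p.2)].
Proof.
have mtr i : measurable [set x : R | Num.truncn x = i].
  (* [Num.truncn] sends negative reals to 0, so the cell of 0 is []-oo, 1[]. *)
  have -> : [set x : R | Num.truncn x = i] =
      [set` if i is j.+1 then `[j.+1%:R, j.+2%:R[ else `]-oo, 0.+1%:R[].
    apply/seteqP; case: i => [|i]; split => x /=; rewrite in_itv /=.
    - by move=> x0; rewrite -truncn_le_nat x0.
    - by rewrite -truncn_le_nat leqn0 => /eqP.
    - by move=> xi; rewrite -truncn_gt_nat -truncn_le_nat xi !leqnn.
    - rewrite -truncn_gt_nat -truncn_le_nat => ?; apply/eqP.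
      by rewrite eqn_leq andbC.
  by case: i => *; exact: measurable_itv.
have -> : [set p : R * R | P (Num.truncn p.1, Num.truncn p.2)] =
    \bigcup_i \bigcup_(j in [set j | P (i, j)])
      ([set x : R | Num.truncn x = i] `*` [set y : R | Num.truncn y = j]).
  apply/seteqP; split => [[x y] /= Pxy|[x y] [i _] [j /= Pij] [/= -> ->]//].
  by exists (Num.truncn x) => //; exists (Num.truncn y).
apply: bigcupT_measurable => i; apply: bigcup_measurable => j _.
exact: measurableX.
Qed.

Lemma measurable_lattice_ext :
  measurable_fun (@plane_dom R) (fun p : R * R => lattice_ext u p.1 p.2).
Proof.
move=> _ Y _.
(* The quadrant is intersected separately because negative coordinates also truncate to 0. *)
have -> : @plane_dom R `&` (fun p => lattice_ext u p.1 p.2) @^-1` Y =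
    ([set` `[0, +oo[] `*` [set` `[0, +oo[]) `&`
    [set p : R * R | (lattice_dom `&` [set q | Y (u q.1 q.2)])
                       (Num.truncn p.1, Num.truncn p.2)].
  apply/seteqP; split => [[x y] [[x0 y0 dxy] Yxy]|[x y]] /=.
    by rewrite !in_itv /= !andbT.
  by rewrite !in_itv /= !andbT => -[[x0 y0] [dxy Yxy]].
apply: measurableI; last exact: measurable_truncn_pair.
by apply: measurableX; exact: measurable_itv.
Qed.

Hypothesis u_decr : eventually_decreasing lattice_dom u.
Local Notation g := (lattice_ext u).

Lemma lattice_ext_decreasing : exists M : R,
  forall x x' y y', M <= x -> x <= x' -> M <= y -> y <= y' -> g x' y' <= g x y.
Proof.
have [M [decr1 decr2]] := u_decr.
(* With [M + 1] in place of [M], truncations are positive even when [M = 0], which keeps every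
   lattice point away from [(0, 0)]. *)
exists M.+1%:R => x x' y y' Mx xx' My yy'.
have tr (z : R) : M.+1%:R <= z -> (M < Num.truncn z)%N.
  by rewrite truncn_gt_nat.
have dom (z t : R) : M.+1%:R <= z -> lattice_dom (Num.truncn z, Num.truncn t).
  move=> /tr Mz; rewrite /lattice_dom /= xpair_eqE negb_and.
  by rewrite -lt0n (leq_ltn_trans _ Mz).
have Mx' := le_trans Mx xx'.
apply: (@le_trans _ _ (g x' y)).
  by apply: decr2; rewrite ?leEnat ?le_truncn//; do ?[exact: dom];
    exact/ltnW/tr.
by apply: decr1; rewrite ?leEnat ?le_truncn//; do ?[exact: dom]; exact/ltnW/tr.
Qed.

Lemma eventually_decreasing_lattice_ext :
  eventually_decreasing (@plane_dom R) g.
Proof.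
have [M decr] := lattice_ext_decreasing.
by exists M; split => [x x' y|x y y'] *; exact: decr.
Qed.

End lattice_extension.

(** * Comparison of nearby scales, and integer parts *)

Lemma regularly_varying_between (R : realType) (a : R) (b : R -> R)
    (v w : R^nat) (s1 s s2 : R) :
  0 < a -> regularly_varying a b -> v @ \oo --> +oo ->
  w n / v n @[n --> \oo] --> s -> 0 < s1 -> s1 < s -> s < s2 ->
  \forall n \near \oo, b (v n) * s1 `^ a <= b (w n) <= b (v n) * s2 `^ a.
Proof.
move=> a0 b_rv voo wv s10 s1s ss2.
have s0 := lt_trans s10 s1s; have s20 := lt_trans s0 ss2.
have blim := regularly_varying_cvg b_rv s0 voo wv.
have lt1 : s1 `^ a < s `^ a by apply: gt0_ltr_powR; rewrite ?nnegrE // ltW.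
have lt2 : s `^ a < s2 `^ a by apply: gt0_ltr_powR; rewrite ?nnegrE // ltW.
have v0 : \forall n \near \oo, 0 < v n by move/cvgryPgt: voo; exact.
have blow : \forall n \near \oo, s1 `^ a < b (w n) / b (v n).
  exact: (cvgr_gt _ blim).
have bup : \forall n \near \oo, b (w n) / b (v n) < s2 `^ a.
  exact: (cvgr_lt _ blim).
apply: filterS3 v0 blow bup => n vn0 /ltW low /ltW up.
have bv0 : 0 < b (v n) by case: b_rv => _ + _; exact.
by rewrite mulrC -ler_pdivlMr// low mulrC -ler_pdivrMr.
Qed.

(** The relative error is below [1 / t n], hence below [e] once [t n > 1 / e]. *)
Lemma cvg_truncn (R : realType) (t : R^nat) : t @ \oo --> +oo ->
  (Num.truncn (t n))%:R / t n @[n --> \oo] --> (1 : R).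
Proof.
move=> too; apply/cvgrPdist_lt => e e0; near=> n.
have t0 : 0 < t n by near: n; move/cvgryPgt : too; exact.
rewrite -[X in `|X - _|](divff (lt0r_neq0 t0)) -mulrBl normrM normfV.
rewrite (gtr0_norm t0).
rewrite ltr_pdivrMr// ger0_norm ?subr_ge0 ?truncn_le ?ltW//.
have : e^-1 < t n by near: n; move/cvgryPgt : too; exact.
rewrite -div1r ltr_pdivrMr// [t n * e]mulrC.
by have := truncnS_gt (t n); rewrite -natr1; lra.
Unshelve. all: by end_near. Qed.

Lemma truncn_cvgy (R : realType) (t : R^nat) : t @ \oo --> +oo ->
  (Num.truncn (t n))%:R @[n --> \oo] --> (+oo : set_system R).
Proof.
move=> too; apply/cvgryPge => A; move/cvgryPge : too => /(_ (A + 1)).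
apply: filterS => n; have := truncnS_gt (t n); rewrite -natr1; lra.
Qed.

(** * Scaling of the limit function and passage from integers to reals *)

Section embedding.
Variables (R : realType) (u : nat -> nat -> R) (a1 a2 : R) (b1 b2 : R -> R).
Variables (rho : R) (h : R -> R) (lam : R -> R -> R).
Hypotheses (u_decr : eventually_decreasing lattice_dom u).
Hypotheses (a1_gt0 : 0 < a1) (a2_gt0 : 0 < a2).
Hypotheses (b1_rv : regularly_varying a1 b1) (b2_rv : regularly_varying a2 b2).
Hypotheses (b1_incr : forall s t : R, 0 < s -> s < t -> b1 s < b1 t).
Hypotheses (b2_incr : forall s t : R, 0 < s -> s < t -> b2 s < b2 t).
Hypothesis h_rv : regularly_varying rho h.
Local Notation g := (lattice_ext u).
Hypothesis g_lim : forall x y : R, 0 < x -> 0 < y ->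
  g (b1 n%:R * x) (b2 n%:R * y) / h n%:R @[n --> \oo] --> lam x y.

Let b1_oo : b1 t @[t --> +oo] --> +oo :=
  incr_regularly_varying_cvgy a1_gt0 b1_rv b1_incr.
Let b2_oo : b2 t @[t --> +oo] --> +oo :=
  incr_regularly_varying_cvgy a2_gt0 b2_rv b2_incr.

(** Since [g] decreases, the bounds on [b1 (w n)] and [b2 (w n)] change sides. Only the arguments
    with [s1], the smallest, have to be compared with the threshold [M]. *)
Lemma lattice_ext_between (v w : R^nat) (s1 s s2 x y : R) :
  v @ \oo --> +oo -> w n / v n @[n --> \oo] --> s ->
  0 < s1 -> s1 < s -> s < s2 -> 0 < x -> 0 < y ->
  \forall n \near \oo,
    g (b1 (v n) * (s2 `^ a1 * x)) (b2 (v n) * (s2 `^ a2 * y))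
      <= g (b1 (w n) * x) (b2 (w n) * y)
      <= g (b1 (v n) * (s1 `^ a1 * x)) (b2 (v n) * (s1 `^ a2 * y)).
Proof.
move=> voo wv s10 s1s ss2 x0 y0.
have [M decr] := lattice_ext_decreasing u_decr.
have large (a z : R) (b : R -> R) : 0 < z -> b t @[t --> +oo] --> +oo ->
    \forall n \near \oo, M <= b (v n) * (s1 `^ a * z).
  move=> z0 boo; have sz0 : 0 < s1 `^ a * z by rewrite mulr_gt0 ?powR_gt0.
  have /cvgryPge/(_ (M / (s1 `^ a * z))) := cvg_comp _ _ voo boo.
  by apply: filterS => n; rewrite ler_pdivrMr.
near=> n.
have /andP[l1 r1] : b1 (v n) * s1 `^ a1 <= b1 (w n) <= b1 (v n) * s2 `^ a1.
  by near: n; exact: (regularly_varying_between _ _ voo wv).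
have /andP[l2 r2] : b2 (v n) * s1 `^ a2 <= b2 (w n) <= b2 (v n) * s2 `^ a2.
  by near: n; exact: (regularly_varying_between _ _ voo wv).
have M1 : M <= b1 (v n) * (s1 `^ a1 * x) by near: n; exact: large.
have M2 : M <= b2 (v n) * (s1 `^ a2 * y) by near: n; exact: large.
rewrite -(ler_pM2r x0) -mulrA in l1; rewrite -(ler_pM2r x0) -mulrA in r1.
rewrite -(ler_pM2r y0) -mulrA in l2; rewrite -(ler_pM2r y0) -mulrA in r2.
apply/andP; split; apply: decr => //.
- exact: le_trans M1 l1.
- exact: le_trans M2 l2.
Unshelve. all: by end_near. Qed.

Let nat_oo : (n%:R : R) @[n --> \oo] --> +oo := cvgr_idn.

Let h_gt0 t : 0 < t -> 0 < h t. Proof. by case: h_rv => _ + _; exact. Qed.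

Lemma lam_bounds (s1 s s2 x y : R) : 0 < s1 -> s1 < s -> s < s2 ->
  0 < x -> 0 < y ->
  lam (s2 `^ a1 * x) (s2 `^ a2 * y) <= s `^ rho * lam x y
    <= lam (s1 `^ a1 * x) (s1 `^ a2 * y).
Proof.
move=> s10 s1s ss2 x0 y0.
have s0 := lt_trans s10 s1s; have s20 := lt_trans s0 ss2.
pose m n := Num.truncn (s * n%:R).
have snoo : s * n%:R @[n --> \oo] --> +oo.
  apply/cvgryPge => A; move/cvgryPge : nat_oo => /(_ (A / s)).
  by apply: filterS => n; rewrite ler_pdivrMr// mulrC.
have moo : (m n)%:R @[n --> \oo] --> (+oo : set_system R) by exact: truncn_cvgy.
have mn : (m n)%:R / n%:R @[n --> \oo] --> s.
  have : (m n)%:R / (s * n%:R) * s @[n --> \oo] --> 1 * s.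
    exact: (cvgMr_tmp (cvg_truncn snoo)).
  rewrite mul1r; apply: cvg_trans; apply: near_eq_cvg; near=> n.
  have n0 : n%:R != 0 :> R.
    by rewrite gt_eqF//; near: n; move/cvgryPgt : nat_oo; exact.
  by rewrite /m; field; rewrite n0 gt_eqF.
(* The hypothesis along the integers [m n] normalises by [h (m n)]; changing to [h n] produces the
   factor [s ^ rho]. *)
have glim : g (b1 (m n)%:R * x) (b2 (m n)%:R * y) / h n%:R @[n --> \oo] -->
    s `^ rho * lam x y.
  have mnat : m @ \oo --> \oo by apply/cvgrnyP; exact: moo.
  have gm := cvg_comp _ _ mnat (g_lim x0 y0).
  have : h (m n)%:R / h n%:R *
      (g (b1 (m n)%:R * x) (b2 (m n)%:R * y) / h (m n)%:R) @[n --> \oo]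
      --> s `^ rho * lam x y.
    exact: cvgM (regularly_varying_cvg h_rv s0 nat_oo mn) gm.
  apply: cvg_trans; apply: near_eq_cvg; near=> n => /=.
  have m0 : h (m n)%:R != 0.
    by rewrite gt_eqF// h_gt0//; near: n; move/cvgryPgt : moo; exact.
  have n0 : h n%:R != 0.
    by rewrite gt_eqF// h_gt0//; near: n; move/cvgryPgt : nat_oo; exact.
  by field; rewrite n0 m0.
have sx0 (r : R) (a z : R) : 0 < r -> 0 < z -> 0 < r `^ a * z.
  by move=> r0 z0; rewrite mulr_gt0 ?powR_gt0.
have h0 : \forall n \near \oo, 0 < h n%:R.
  by near=> n; rewrite h_gt0//; near: n; move/cvgryPgt : nat_oo; exact.
have btw := lattice_ext_between nat_oo mn s10 s1s ss2 x0 y0.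
apply/andP; split.
- apply: (ler_cvg_to (g_lim (sx0 s2 a1 x s20 x0) (sx0 s2 a2 y s20 y0)) glim).
  apply: filterS2 btw h0 => n /andP[+ _] h0.
  by rewrite ler_pM2r ?invr_gt0.
- apply: (ler_cvg_to glim (g_lim (sx0 s1 a1 x s10 x0) (sx0 s1 a2 y s10 y0))).
  apply: filterS2 btw h0 => n /andP[_ +] h0.
  by rewrite ler_pM2r ?invr_gt0.
Unshelve. all: by end_near. Qed.

Lemma lam_scaling (s x y : R) : 0 < s -> 0 < x -> 0 < y ->
  lam (s `^ a1 * x) (s `^ a2 * y) = s `^ rho * lam x y.
Proof.
move=> s0 x0 y0.
have powlam : r `^ rho * lam x y @[r --> s] --> s `^ rho * lam x y.
  by apply: cvgMr_tmp; exact: powR_continuous.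
(* In [lam_bounds], [s] is placed at an outer position and [r] in the middle: as [s2] with [r]
   increasing to [s], then as [s1] with [r] decreasing to [s]. The points [r / 2] and [r + 1] only
   fill the remaining position. *)
apply/eqP; rewrite eq_le; apply/andP; split.
- apply: (@ler_cvg_to R s^'- _ R (cst _) _ _ _ (cvg_cst _)
    (cvg_at_left_filter powlam)).
  near=> r; have r0 : 0 < r.
    by near: r; exact: nbhs_left_gt.
  have rs : r < s by near: r; exact: nbhs_left_lt.
  have r20 : 0 < r / 2 by rewrite divr_gt0.
  have r2r : r / 2 < r by lra.
  by have /andP[] := lam_bounds r20 r2r rs x0 y0.
- apply: (@ler_cvg_to R s^'+ _ R _ (cst _) _ _
    (cvg_at_right_filter powlam) (cvg_cst _)).
  near=> r; have sr : s < r by near: r; exact: nbhs_right_gt.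
  have r1 : r < r + 1 by lra.
  by have /andP[] := lam_bounds s0 sr r1 x0 y0.
Unshelve. all: by end_near. Qed.

(** The limit is tested along sequences [t], comparing scale [t k] with its integer part, where the
    hypothesis applies. *)
Lemma lattice_ext_cvg (x y : R) : 0 < x -> 0 < y ->
  g (b1 t * x) (b2 t * y) / h t @[t --> +oo] --> lam x y.
Proof.
move=> x0 y0; apply/cvg_pinftyP => t too.
pose n k := Num.truncn (t k).
have noo : (n k)%:R @[k --> \oo] --> (+oo : set_system R) by exact: truncn_cvgy.
have t0 : \forall k \near \oo, 0 < t k by move/cvgryPgt : too; exact.
have n0 : \forall k \near \oo, 0 < (n k)%:R :> R by move/cvgryPgt : noo; exact.
have nt := cvg_truncn too.
have tn : t k / (n k)%:R @[k --> \oo] --> (1 : R).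
  have : ((n k)%:R / t k)^-1 @[k --> \oo] --> (1 : R)^-1.
    by apply: cvgV; [rewrite oner_eq0|exact: nt].
  by rewrite invr1; under eq_fun do rewrite invf_div.
have hlim : h (n k)%:R / h (t k) @[k --> \oo] --> (1 : R).
  by have := regularly_varying_cvg h_rv ltr01 too nt; rewrite powR1.
have powlam : r `^ rho * lam x y @[r --> (1 : R)] --> lam x y.
  have : r `^ rho * lam x y @[r --> (1 : R)] --> 1 `^ rho * lam x y.
    by apply: cvgMr_tmp; exact: powR_continuous.
  by rewrite powR1 mul1r.
have nnat : n @ \oo --> \oo by apply/cvgrnyP; exact: noo.
have qlim : g (b1 (t k) * x) (b2 (t k) * y) / h (n k)%:R @[k --> \oo]
    --> lam x y.
  (* The scaling property identifies the limits of the outer terms of the sandwich as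
     [r ^ rho * lam x y], which are close to [lam x y] for [r] near 1. *)
  have glim (r : R) : 0 < r ->
      g (b1 (n k)%:R * (r `^ a1 * x)) (b2 (n k)%:R * (r `^ a2 * y)) / h (n k)%:R
        @[k --> \oo] --> r `^ rho * lam x y.
    move=> r0; rewrite -lam_scaling//.
    have sx0 a z : 0 < z -> 0 < r `^ a * z.
      by move=> z0; rewrite mulr_gt0 ?powR_gt0.
    exact: (cvg_comp _ _ nnat (g_lim (sx0 a1 x x0) (sx0 a2 y y0))).
  apply/cvgrPdist_lt => e e0.
  move/cvgrPdist_lt : powlam => /(_ e e0) powlam.
  have [s1 [s10 s11 s1e]] : exists s1, [/\ 0 < s1, s1 < 1 &
      `|lam x y - s1 `^ rho * lam x y| < e].
    apply: (@filter_ex _ (1 : R)^'-); near=> r; split; near: r.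
    - exact: nbhs_left_gt.
    - exact: nbhs_left_lt.
    - exact: (cvg_within _ powlam).
  have [s2 [s21 s2e]] : exists s2, 1 < s2 /\
      `|lam x y - s2 `^ rho * lam x y| < e.
    apply: (@filter_ex _ (1 : R)^'+); near=> r; split; near: r.
    - exact: nbhs_right_gt.
    - exact: (cvg_within _ powlam).
  have s20 : 0 < s2 by exact: lt_trans s21.
  have btw := lattice_ext_between noo tn s10 s11 s21 x0 y0.
  have up : \forall k \near \oo,
      g (b1 (n k)%:R * (s1 `^ a1 * x)) (b2 (n k)%:R * (s1 `^ a2 * y))
        / h (n k)%:R
        < lam x y + e.
    by apply: (cvgr_lt _ (glim s1 s10)); move: s1e; rewrite ltr_norml; lra.
  have low : \forall k \near \oo, lam x y - e <
      g (b1 (n k)%:R * (s2 `^ a1 * x)) (b2 (n k)%:R * (s2 `^ a2 * y))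
        / h (n k)%:R.
    by apply: (cvgr_gt _ (glim s2 s20)); move: s2e; rewrite ltr_norml; lra.
  apply: filterS2 (filterI btw n0) (filterI low up).
  move=> k [/andP[gl gu] nk0] [lk uk].
  have hn0 : 0 < (h (n k)%:R)^-1 by rewrite invr_gt0 h_gt0.
  rewrite -(ler_pM2r hn0) in gl; rewrite -(ler_pM2r hn0) in gu.
  by rewrite ltr_distlC (lt_le_trans lk gl) (le_lt_trans gu uk).
(* The normalisation passes from [h (n k)] to [h (t k)]; their ratio tends to 1. *)
rewrite -[lam x y]mulr1.
have : g (b1 (t k) * x) (b2 (t k) * y) / h (n k)%:R * (h (n k)%:R / h (t k))
    @[k --> \oo] --> lam x y * 1 by exact: cvgM qlim hlim.
apply: cvg_trans; apply: near_eq_cvg; apply: filterS2 t0 n0 => k t0 n0 /=.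
by rewrite mulrA divfK// gt_eqF// h_gt0.
Unshelve. all: by end_near. Qed.

Lemma rv2_limit_lattice_ext : (forall x y : R, 0 < x -> 0 < y -> 0 < lam x y) ->
  rv2_limit b1 b2 h lam g.
Proof.
move=> lam_gt0 x y x0 y0; split; [|exact: lattice_ext_cvg|exact: lam_gt0].
(* An argument at least 1 has positive integer part, so the point lies in [plane_dom]. *)
have large (z : R) (b : R -> R) : 0 < z -> b t @[t --> +oo] --> +oo ->
    \forall t \near +oo, 1 <= b t * z.
  move=> z0 /cvgryPge/(_ (1 / z)).
  by apply: filterS => n; rewrite ler_pdivrMr.
apply: filterS2 (large x b1 x0 b1_oo) (large y b2 y0 b2_oo) => t b1x b2y.
split; rewrite /= ?(le_trans ler01)//.
by rewrite /lattice_dom /= xpair_eqE negb_and -lt0n truncn_gt0 b1x.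
Qed.
End embedding.

Theorem corollary3p1 (R : realType) (u : nat -> nat -> R)
  (u_ge0 : forall i j : nat, lattice_dom (i, j) -> 0 <= u i j)
  (u_decr : eventually_decreasing lattice_dom u)
  (alpha1 alpha2 : R) (alpha1_gt0 : 0 < alpha1) (alpha2_gt0 : 0 < alpha2)
  (b1 b2 : R -> R)
  (b1_rv : regularly_varying (1 / alpha1) b1)
  (b2_rv : regularly_varying (1 / alpha2) b2)
  (b1_cont : {within `]0, +oo[, continuous b1})
  (b2_cont : {within `]0, +oo[, continuous b2})
  (b1_incr : forall s t : R, 0 < s -> s < t -> b1 s < b1 t)
  (b2_incr : forall s t : R, 0 < s -> s < t -> b2 s < b2 t)
  (rho : R) (rho_lt0 : rho < 0)
  (h : R -> R) (h_rv : regularly_varying rho h)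
  (lam : R -> R -> R)
  (u_lim : forall x y : R, 0 < x -> 0 < y ->
     u (Num.truncn (b1 n%:R * x)) (Num.truncn (b2 n%:R * y)) / h n%:R
       @[n --> \oo] --> lam x y)
  (lam_gt0 : forall x y : R, 0 < x -> 0 < y -> 0 < lam x y) :
  [/\ (forall s x y : R, 0 < s -> 0 < x -> 0 < y ->
         lam (s `^ (1 / alpha1) * x) (s `^ (1 / alpha2) * y)
         = s `^ rho * lam x y),
      eventually_decreasing (@plane_dom R) (lattice_ext u),
      regularly_varying2 b1 b2 lam (lattice_ext u),
      rv2_limit b1 b2 h lam (lattice_ext u) &
      embeddable u].
Proof.
have a1_gt0 : 0 < 1 / alpha1 by rewrite divr_gt0.
have a2_gt0 : 0 < 1 / alpha2 by rewrite divr_gt0.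
have lim_g : rv2_limit b1 b2 h lam (lattice_ext u).
  exact: (rv2_limit_lattice_ext u_decr a1_gt0 a2_gt0 b1_rv b2_rv b1_incr
    b2_incr h_rv u_lim lam_gt0).
have rv_g : regularly_varying2 b1 b2 lam (lattice_ext u).
  by split; [exact: measurable_lattice_ext|exists rho, h].
split=> //.
- move=> s x y.
  exact: (lam_scaling u_decr a1_gt0 a2_gt0 b1_rv b2_rv b1_incr b2_incr
    h_rv u_lim).
- exact: eventually_decreasing_lattice_ext.
- by exists b1, b2, lam.
Qed.
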